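(* Let $C^0([0,1])$ be the space of continuous maps $f:[0,1]\to[0,1]$ endowed with the uniform metric, and let $d$ be the Euclidean metric on $[0,1]$. For every $\beta\in[0,1]$ there exists a dense subset $\mathcal{D}_\beta\subset C^0([0,1])$ such that $$\underline{\mathrm{mdim}_M}\,([0,1],f,d)=\overline{\mathrm{mdim}_M}\,([0,1],f,d)=\beta\qquad\text{for every } f\in\mathcal{D}_\beta.$$ Moreover, there is a Baire residual subset of $C^0([0,1])$ such that every $f$ in it satisfies $\overline{\mathrm{mdim}_M}\,([0,1],f,d)=1$.
   Context: The uniform metric on $C^0([0,1])$ is $(f,g)\mapsto\max_{x\in[0,1]}|f(x)-g(x)|$. A subset is Baire residual if it contains a countable intersection of open dense subsets. Metric mean dimensions: for a continuous map $f: X\to X$ of a compact metric space $(X,d)$ and $n\in\mathbb{N}$, let $d_n(x,y)=\max_{0\leqslant j\leqslant n-1} d(f^j(x),f^j(y))$. Given $\varepsilon>0$, a set $A\subset X$ is $(n,\varepsilon)$-separated by $f$ if $d_n(x,y)>\varepsilon$ for all distinct $x,y\in A$; $s(f,n,\varepsilon)$ denotes the maximal cardinality of an $(n,\varepsilon)$-separated subset of $X$. Put $h(f,\varepsilon)=\limsup_{n\to+\infty}\frac1n\log s(f,n,\varepsilon)$. The lower and upper metric mean dimensions are $$\underline{\mathrm{mdim}_M}\,(X,f,d)=\liminf_{\varepsilon\to 0^+}\frac{h(f,\varepsilon)}{|\log\varepsilon|},\qquad \overline{\mathrm{mdim}_M}\,(X,f,d)=\limsup_{\varepsilon\to 0^+}\frac{h(f,\varepsilon)}{|\log\varepsilon|}.$$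 *)

(* Defs.v *)
From HB Require Import structures.
From mathcomp Require Import all_boot all_order all_algebra finmap.
From mathcomp Require Import all_classical all_reals all_analysis.
Set Implicit Arguments.
Unset Strict Implicit.
Unset Printing Implicit Defensive.
Import Order.TTheory GRing.Theory Num.Theory.
Import numFieldNormedType.Exports.
Local Open Scope classical_set_scope.
Local Open Scope ring_scope.

Section UnitInterval.
Context {R : realType}.

Definition unit_interval : Type := set_type `[0 : R, 1 : R].

HB.instance Definition _ :=
  PseudoMetric.copy unit_interval (set_type `[0 : R, 1 : R]).

Implicit Types x y : unit_interval.

Definition euclidean_dist x y : R := `|val x - val y|.

Lemma euclidean_dist_ge0 x y : 0 <= euclidean_dist x y.
Proof. exact: normr_ge0. Qed.

Lemma euclidean_dist_eq0 x y : euclidean_dist x y = 0 -> x = y.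
Proof. by move=> /eqP; rewrite normr_eq0 subr_eq0 => /eqP /val_inj. Qed.

Lemma ball_euclidean_dist x (e : R) :
  ball x e = [set y | euclidean_dist x y < e].
Proof. by []. Qed.

HB.instance Definition _ := @PseudoMetric_isMetric.Build R unit_interval
  euclidean_dist euclidean_dist_ge0 euclidean_dist_eq0 ball_euclidean_dist.

Fact unit_interval0_subproof : (0 : R) \in `[0 : R, 1 : R]%classic.
Proof. by rewrite inE /= in_itv /= lexx ler01. Qed.

Definition unit_interval0 : unit_interval := SigSub unit_interval0_subproof.

Lemma unit_interval_compact : compact [set: unit_interval].
Proof.
pose f (x : R) : unit_interval := insubd unit_interval0 x.
have fK (x : unit_interval) : f (val x) = x by rewrite /f valKd.
have -> : [set: unit_interval] = f @` `[0 : R, 1 : R].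
  apply/seteqP; split => // x _; exists (val x) => //.
  by have := valP x; rewrite inE.
apply: continuous_compact; last exact: segment_compact.
apply/subspace_sigL_continuousP.
have -> : sigL `[0 : R, 1 : R] f = id by apply/funext => x; exact: fK.
by move=> x; exact: cvg_id.
Qed.

End UnitInterval.
Arguments unit_interval R : clear implicits.

Section C0.
Context {R : realType}.
Local Notation I := (unit_interval R).

Definition C0I : Type := continuousType I I.

HB.instance Definition _ := Choice.copy C0I (continuousType I I).

Definition C0I_fun (f : C0I) : I -> I := f : continuousType I I.
Coercion C0I_fun : C0I >-> Funclass.

Implicit Types f g : C0I.

Definition uniform_dist f g : R := sup [set mdist (f x) (g x) | x in [set: I]].

(* The supremum is attained: [uniform_dist] is a maximum. *)
Lemma uniform_dist_max f g : exists2 x, uniform_dist f g = mdist (f x) (g x) &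
  forall y, mdist (f y) (g y) <= mdist (f x) (g x).
Proof.
pose h (x : I) : R := mdist (f x) (g x).
have ch : continuous h.
  have vc : continuous (val : I -> R) by exact: initial_continuous.
  have kc (k : C0I) : continuous (fun x : I => val (k x) : R).
    by move=> x; apply: (@continuous_comp _ _ _ (k : I -> I) val);
      [exact: (@cts_fun _ _ (k : continuousType I I))|exact: vc].
  by move=> x; exact: (cvg_norm (cvgB (kc f x) (kc g x))).
have [|x _ xm] := @compact_EVT_max I R h setT _ unit_interval_compact
  (continuous_subspaceT ch).
  by exists unit_interval0.
have {}xm y : h y <= h x by apply: xm; rewrite inE.
exists x => //; apply/eqP; rewrite eq_le; apply/andP; split.
  apply: ge_sup => [|_ [y _ <-]]; last exact: xm.
  by exists (h x); exists x.
apply: ub_le_sup; last by exists x.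
by exists (h x) => _ [y _ <-]; exact: xm.
Qed.

Lemma le_uniform_dist f g x : mdist (f x) (g x) <= uniform_dist f g.
Proof. by have [y -> ] := uniform_dist_max f g. Qed.

Lemma uniform_dist_xx f : uniform_dist f f = 0.
Proof. by have [x ->] := uniform_dist_max f f; rewrite mdistxx. Qed.

Lemma uniform_dist_eq0 f g : uniform_dist f g = 0 -> f = g.
Proof.
move=> fg0; apply/continuousEP => x; apply: mdist_positivity.
by apply/eqP; rewrite eq_le mdist_ge0 andbT -fg0 le_uniform_dist.
Qed.

Lemma uniform_dist_sym f g : uniform_dist f g = uniform_dist g f.
Proof.
rewrite /uniform_dist; congr (sup _).
by apply: eq_imagel => x _; rewrite metric_sym.
Qed.

Lemma uniform_dist_triangle g f h :
  uniform_dist f h <= uniform_dist f g + uniform_dist g h.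
Proof.
have [x -> _] := uniform_dist_max f h.
by rewrite (le_trans (metric_triangle _ (g x) _)) // lerD // le_uniform_dist.
Qed.

HB.instance Definition _ := @isMetric.Build R C0I
  uniform_dist uniform_dist_xx uniform_dist_eq0 uniform_dist_sym
  uniform_dist_triangle.

End C0.
Arguments C0I R : clear implicits.

Definition residual (T : topologicalType) (A : set T) : Prop :=
  exists U : nat -> set T,
    (forall k, open (U k) /\ dense (U k)) /\ \bigcap_k U k `<=` A.

Section MetricMeanDimension.
Context {R : realType} {X : metricType R}.
Variable f : X -> X.

(* Distances being nonnegative, the default value 0 is harmless for [0 < n]. *)
Definition bowen_dist (n : nat) (x y : X) : R :=
  \big[Num.max/0]_(0 <= j < n) mdist (iter j f x) (iter j f y).

Definition separated (n : nat) (e : R) (A : set X) : Prop :=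
  forall x y, A x -> A y -> x <> y -> e < bowen_dist n x y.

Local Open Scope ereal_scope.

(* The supremum ranges over finite sets only: subsets of separated sets are
   separated, so it is +oo when some infinite set is separated, which cannot
   happen for [f] continuous and [X] compact. *)
Definition max_separated (n : nat) (e : R) : \bar R :=
  ereal_sup [set (#|` A|)%:R%:E | A in [set A : {fset X} |
    separated n e [set` A]]].

(* The term [n = 0], where [0^-1 = 0], does not affect the limit superior. *)
Definition entropy_at (e : R) : \bar R :=
  limn_esup (fun n => (n%:R^-1)%:E * lne (max_separated n e)).

Definition lower_mdim : \bar R :=
  limf_einf (fun e : R => entropy_at e * (`|ln e|^-1)%:E) 0^'+.

Definition upper_mdim : \bar R :=
  limf_esup (fun e : R => entropy_at e * (`|ln e|^-1)%:E) 0^'+.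

End MetricMeanDimension.

(* Main.v *)
Require Import Defs.
From mathcomp Require Import all_boot all_order all_algebra finmap.
From mathcomp Require Import all_classical all_reals all_analysis.
From mathcomp Require Import ring lra.
Import Order.TTheory GRing.Theory Num.Theory.
Import numFieldNormedType.Exports.
Local Open Scope classical_set_scope.
Local Open Scope ring_scope.

(** Upper bounds come from a modulus of continuity, lower bounds from
    horseshoes, and one explicit perturbation has both.

    Upper bound. If [f] is Hoelder with exponent [1 - b], it sends a set of
    diameter at most [e] into an interval of length [2 C e^(1-b)], which is cut
    into about [2 C e^(-b)] cells of size [e].  Following an orbit cell by cell,
    an [(n, e)]-separated set has at most [K (2 C e^(-b) + 1)^n] points, so
    [h(f, e) <= b |ln e| + O(1)] and the upper dimension is at most [b]
    ([holder_upper_mdim_le]).  Every map is Hoelder with exponent [0], which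
    bounds every upper dimension by [1].

    Lower bound. If [f] stretches each of [N] subintervals of [[l, r]], lying at
    distance more than [e] from each other, strictly across [[l, r]], then each
    word of length [n] over [N] letters is the itinerary of a point, so
    [h(f, e) >= ln N] ([ln_le_entropy_horseshoe]).  Such a horseshoe survives a
    small uniform perturbation ([near_horseshoe]).

    For every [b], maps that are Hoelder with exponent [1 - b] and have, at each
    small scale [e], a horseshoe with at least [e^(-b + o(1))] legs are dense
    ([dense_holder_rich]); their two dimensions equal [b]
    ([holder_rich_mdim]).  To find one near [g], approximate [g] by a Lipschitz
    [G], pick [q < 1] almost fixed by [G], and clamp
    [q + psi(x - q)] between [G - d] and [G + d]: the result is close to [G]
    everywhere and equals [q + psi(x - q)] near [q] up to truncations that do
    not affect the crossings.  Here [psi] is a supremum of tents accumulating at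
    [0]: block [k] consists of tents of width [w = exp(-k^2)] and height
    [h = w^(1-b) exp(-2k)], placed over [[h/3, 2h/3]], hence high enough to
    cross the block and numerous enough,
    about [h / (3 w) = exp(b k^2 - 2k) / 3], to give exponent [b].  Since
    [(k + 1)^2 / k^2] tends to [1], the scales [exp(-k^2)] are dense enough on
    the logarithmic axis to control all [e], even for [b = 1].

    For the residual set, let [U k] be the set of maps having, at some scale [e]
    with [|ln e| >= k], a horseshoe whose number of legs is at least
    [e^(-(1 - 1/(k+1)))].  It is open because horseshoes are stable, and dense
    because it contains the dense family above for [b = 1]; maps in all the
    [U k] have upper dimension [1] ([residual_upper_mdim1]). *)

(** * Separated sets and entropy at a fixed scale *)

Section SeparatedSets.
Context {R : realType} {X : metricType R}.
Implicit Types (f : X -> X) (x y : X) (e : R).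

Lemma mdist_le_bowen f n x y j : (j < n)%N ->
  mdist (iter j f x) (iter j f y) <= bowen_dist f n x y.
Proof.
move=> jn; rewrite /bowen_dist big_mkord.
exact: (le_bigmax _ (fun j : 'I_n => mdist (iter j f x) (iter j f y)) (Ordinal jn)).
Qed.

Lemma lt_bowenP f n e x y : 0 <= e -> e < bowen_dist f n x y ->
  exists2 j, (j < n)%N & e < mdist (iter j f x) (iter j f y).
Proof.
move=> e0; apply: contraPP => /forall2NP nj; apply/negP; rewrite -leNgt.
rewrite /bowen_dist big_mkord; apply: bigmax_le => // j _.
by rewrite leNgt; apply/negP; case: (nj j) => // /(_ (ltn_ord j)).
Qed.

Lemma max_separated_ge1 f n e x : (1 <= max_separated f n e)%E.
Proof.
apply: ereal_sup_ubound; exists [fset x]%fset; last by rewrite cardfs1.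
by move=> a b /=; rewrite !inE => /eqP -> /eqP ->.
Qed.

(** Symbolic coding: choosing a preimage in [J i] for each letter and each point
    of [K], a word is realized by pulling [y0] back along its letters, last
    letter first.  Words differing at time [j] give orbits in different [J i]
    at time [j]. *)
Lemma expn_le_max_separated f n e (K : set X) (J : nat -> set X) N y0 :
  0 <= e -> K y0 ->
  (forall i y, (i < N)%N -> K y -> exists x, [/\ K x, J i x & f x = y]) ->
  (forall i j x y, (i < N)%N -> (j < N)%N -> i != j -> J i x -> J j y ->
    e < mdist x y) ->
  (((N ^ n)%N%:R)%:E <= max_separated f n e)%E.
Proof.
move=> e0 Ky0 cover sep.
pose P (i : 'I_N) y := if pselect (K y) is left Ky then
  sval (cid (cover i y (ltn_ord i) Ky)) else y.
have PP i y : K y -> [/\ K (P i y), J i (P i y) & f (P i y) = y].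
  by rewrite /P; case: pselect => // Ky _; case: cid.
pose pt (w : seq 'I_N) := foldr P y0 w.
have ptK w : K (pt w) by elim: w => //= i w /(PP i)[].
have iter_pt j w : (j <= size w)%N -> iter j f (pt w) = pt (drop j w).
  elim: j w => [|j IH] [|i w] //= jw.
  by rewrite -iterS iterSr; have [_ _ ->] := PP i _ (ptK w); exact: IH.
have ptJ j w (i0 : 'I_N) : (j < size w)%N -> J (nth i0 w j) (iter j f (pt w)).
  move=> jw; rewrite iter_pt 1?ltnW// (drop_nth i0)//=.
  by have [] := PP (nth i0 w j) _ (ptK (drop j.+1 w)).
have ptsep (w w' : n.-tuple 'I_N) : w != w' -> e < bowen_dist f n (pt w) (pt w').
  move=> ww'; have [j jww'] : exists j : 'I_n, tnth w j != tnth w' j.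
    by apply/existsP; apply: contraNT ww'; rewrite negb_exists => /forallP h;
      apply/eqP/eq_from_tnth => j; apply/eqP; rewrite -[_ == _]negbK.
  apply: lt_le_trans (mdist_le_bowen f n _ _ j (ltn_ord j)).
  apply: (sep (tnth w j) (tnth w' j)); rewrite ?ltn_ord//.
    by rewrite (tnth_nth (tnth w j)); apply: ptJ; rewrite size_tuple.
  by rewrite (tnth_nth (tnth w j)); apply: ptJ; rewrite size_tuple.
have ptinj : injective (fun w : n.-tuple 'I_N => pt w).
  move=> w w' /= eqw; apply/eqP; apply: contraT => /ptsep; rewrite eqw.
  move=> /(lt_bowenP f n e _ _ e0)[j _]; rewrite mdistxx.
  by rewrite ltNge e0.
apply: ereal_sup_ubound; exists [fset x in [seq pt (tval w) | w <- enum {: n.-tuple 'I_N}]]%fset.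
  move=> x y /=; rewrite !inE => /mapP[w _ ->] /mapP[w' _ ->] ne.
  by apply: ptsep; apply: contra_notN ne => /eqP ->.
rewrite card_fseq undup_id; last by rewrite map_inj_uniq// enum_uniq.
by rewrite size_map -cardT card_tuple card_ord.
Qed.

End SeparatedSets.

Section Entropy.
Context {R : realType} {X : metricType R}.
Implicit Types (f : X -> X) (e : R).

(** Only arbitrarily large [n] matter to the limit superior, so [n = m.+1] is
    used past any rank [m].  For [N = 0], where [ln 0 = 0], the bound
    holds because a singleton is separated. *)
Lemma ln_le_entropy f e (N : nat) (x0 : X) :
  (forall n, ((N ^ n)%N%:R)%:E <= max_separated f n e)%E ->
  ((ln N%:R)%:E <= entropy_at f e)%E.
Proof.
move=> sN; rewrite /entropy_at /limn_esup /limf_esup.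
apply: le_ereal_inf_tmp => _ [V [m _ mV]] <-.
apply: le_ereal_sup_tmp.
exists ((m.+1)%:R^-1%:E * lne (max_separated f m.+1 e))%E.
  by exists m.+1 => //; apply: mV => /=.
have := sN m.+1; set s := max_separated _ _ _ => Ns.
have s1 : (1 <= s)%E := max_separated_ge1 f m.+1 e x0.
have [N0|N0] := posnP N.
  rewrite N0 ln0//; apply: mule_ge0; rewrite ?lee_fin ?invr_ge0//.
  by rewrite lne_ge0.
have -> : (ln N%:R)%:E = (m.+1%:R^-1%:E * lne ((N ^ m.+1)%N%:R)%:E)%E :> \bar R.
  rewrite lne_EFin ?ltr0n ?expn_gt0 ?N0// natrX lnXn ?ltr0n// -EFinM.
  by rewrite -(mulr_natl (ln _)) mulKf// pnatr_eq0.
apply: lee_wpmul2l; first by rewrite lee_fin invr_ge0.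
rewrite lee_lne// in_itv/= ?leey ?andbT.
  by rewrite lee_fin.
exact: le_trans s1.
Qed.

(** The constant [K] disappears in the limit, since [ln K / n] tends to [0]. *)
Lemma entropy_le_ln f e (K M : nat) : (0 < K)%N -> (0 < M)%N ->
  (forall n (A : {fset X}), Defs.separated f n e [set` A] -> (#|` A| <= K * M ^ n)%N) ->
  (entropy_at f e <= (ln M%:R)%:E)%E.
Proof.
move=> K0 M0 count; apply/lee_addgt0Pr => r r0.
have [m mr] : exists m : nat, (0 < m)%N /\ ln K%:R <= r * m%:R.
  exists (Num.truncn (ln K%:R / r)).+1; split=> //.
  by rewrite mulrC -ler_pdivrMr// ltW// truncnS_gt.
apply: ge_ereal_inf; exists (ereal_sup ((fun n => (n%:R^-1)%:E * lne (max_separated f n e))%E @` [set n | (m <= n)%N])).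
  by exists [set n | (m <= n)%N] => //; exists m.
case: mr => m0 mr; apply: ge_ereal_sup => _ [n /= mn <-].
have n0 : (0 < n)%N by exact: leq_trans mn.
have : (max_separated f n e <= ((K * M ^ n)%N%:R)%:E)%E.
  by apply: ge_ereal_sup => _ [A /= sA <-]; rewrite lee_fin ler_nat; exact: count.
have KM0 : (0 < (K * M ^ n)%N%:R :> R) by rewrite ltr0n muln_gt0 K0 expn_gt0 M0.
move=> sKM; have : (lne (max_separated f n e) <= (ln ((K * M ^ n)%N%:R))%:E)%E.
  have [s0|s0] := leP (max_separated f n e) 0%E.
    by rewrite le0_lneNy// leNye.
  rewrite -lne_EFin// lee_lne// in_itv/= leey andbT ?(ltW s0)//.
have n_ge0 : (0 <= (n%:R^-1 : R)%:E)%E by rewrite lee_fin invr_ge0.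
move=> /(lee_wpmul2l n_ge0)/le_trans; apply; rewrite -EFinM -EFinD lee_fin.
rewrite natrM natrX lnM ?posrE ?exprn_gt0 ?ltr0n// lnXn ?ltr0n//.
rewrite mulrC ler_pdivrMr ?ltr0n// mulrDl mulr_natr addrC lerD2l.
by apply: (le_trans mr); rewrite ler_wpM2l ?(ltW r0)// ler_nat.
Qed.

End Entropy.

(** * Hoelder maps of the interval *)

Section Holder.
Context {R : realType}.
Notation I := (unit_interval R).
Implicit Types (f : I -> I) (x y : I) (e : R).

Lemma mdistE x y : mdist x y = `|val x - val y|.
Proof. by []. Qed.

Lemma val_I x : 0 <= val x <= 1.
Proof. by have := valP x; rewrite inE /= in_itv. Qed.

Lemma mdist_le1 x y : mdist x y <= 1.
Proof. by rewrite mdistE; have := val_I x; have := val_I y; rewrite ler_norml; lra. Qed.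

Definition holder (a : R) f := exists2 C, 0 <= C &
  forall x y, mdist (f x) (f y) <= C * mdist x y `^ a.

(** Pigeonhole over the cells [[t + k e, t + (k + 1) e)] that meet
    [[t, t + W]]; two points of the same cell are at distance at most [e]. *)
Lemma size_le_cells (s : seq I) (t W e : R) (m : nat) : 0 < e ->
  {in s, forall x, t <= val x <= t + W} ->
  (forall s', subseq s' s -> {in s' &, forall x y, mdist x y <= e} ->
    (size s' <= m)%N) ->
  (size s <= (Num.truncn (W / e)).+1 * m)%N.
Proof.
move=> e0 sW sub; pose c x := Num.truncn ((val x - t) / e).
have cle x : x \in s -> (c x < (Num.truncn (W / e)).+1)%N.
  move=> /sW/andP[tx xW]; rewrite ltnS /c; apply: le_truncn.
  by rewrite ler_pM2r ?invr_gt0//; lra.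
have cell x y : x \in s -> y \in s -> c x = c y -> mdist x y <= e.
  move=> /sW/andP[tx _] /sW/andP[ty _] cxy.
  have h z : t <= val z -> (c z)%:R * e <= val z - t < (c z).+1%:R * e.
    move=> tz; have z0 : 0 <= (val z - t) / e by rewrite divr_ge0 ?(ltW e0)//; lra.
    have /andP[c1 c2] := truncn_itv z0.
    by rewrite -ler_pdivlMr// c1 -ltr_pdivrMr.
  have := h x tx; have := h y ty; rewrite cxy -[(c y).+1]addn1 natrD mulrDl mul1r mdistE.
  by rewrite ler_norml; lra.
rewrite -sum1_size (partition_big (fun x => inord (c x) : 'I_(Num.truncn (W / e)).+1) xpredT)//=.
apply: (@leq_trans (\sum_(k < (Num.truncn (W / e)).+1) m)); last first.
  by rewrite sum_nat_const card_ord.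
apply: leq_sum => k _; rewrite -big_filter sum1_size; apply: sub.
  exact: filter_subseq.
move=> x y; rewrite !mem_filter => /andP[/eqP xk xs] /andP[/eqP yk ys].
apply: cell => //.
by have := congr1 val (etrans xk (esym yk)); rewrite /= !inordK ?cle.
Qed.

(** Induction on [n].  Two points of [s] are [e]-close at time [0], so they are
    separated by their images: [f] is injective on [s], and [map f s] is
    separated for [n - 1] steps and lies in an interval of length [2 W], whose
    cells are handled by induction. *)
Lemma size_separated_le f e W n (s : seq I) : 0 < e ->
  (forall x y, mdist x y <= e -> mdist (f x) (f y) <= W) ->
  uniq s -> {in s &, forall x y, mdist x y <= e} ->
  {in s &, forall x y, x <> y -> e < bowen_dist f n x y} ->
  (size s <= (Num.truncn (2 * W / e)).+1 ^ n)%N.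
Proof.
move=> e0 fW; set M := (_.+1); elim: n s => [|n IH] s us cl sep.
  case: s us cl sep => [|x [|y s]]//= /andP[xy _] _ /(_ x y).
  rewrite !inE !eqxx orbT /= /bowen_dist big_nil => /(_ isT isT).
  have ne : x <> y by move=> exy; move: xy; rewrite exy inE eqxx.
  by move=> /(_ ne); rewrite ltNge (ltW e0).
have sep' : {in s &, forall x y, x <> y -> e < bowen_dist f n (f x) (f y)}.
  move=> x y xs ys xy; have [[|j] jn ej] := lt_bowenP _ _ _ _ _ (ltW e0) (sep x y xs ys xy).
    by move: ej; rewrite ltNge /= cl.
  by apply: (lt_le_trans ej); rewrite !iterSr; exact: mdist_le_bowen.
have finj : {in s &, injective f}.
  move=> x y xs ys fxy; apply: contrapT => xy.
  have [j _] := lt_bowenP _ _ _ _ _ (ltW e0) (sep' x y xs ys xy).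
  by rewrite fxy mdistxx ltNge (ltW e0).
have [->|[x0 x0s]] : s = [::] \/ exists x, x \in s.
- by case: (s) => [|x s']; [left|right; exists x; rewrite mem_head].
- by [].
rewrite -(size_map f) expnS.
apply: (@size_le_cells _ (val (f x0) - W) (2 * W)) => //.
  move=> _ /mapP[x xs ->]; have := fW x x0 (cl x x0 xs x0s).
  by rewrite mdistE ler_norml; lra.
move=> s' ss' cl'; apply: IH => //.
  by apply: subseq_uniq ss' _; rewrite map_inj_in_uniq.
move=> _ _ /(mem_subseq ss')/mapP[x xs ->] /(mem_subseq ss')/mapP[y ys ->] ne.
by apply: sep' => // exy; apply: ne; rewrite exy.
Qed.

(** At scale [e] the number of cells reached from one cell is about
    [2 C e^a / e = 2 C exp((1 - a) |ln e|)]. *)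
Lemma holder_entropy_le f (a C e : R) : 0 <= a <= 1 -> 0 <= C ->
  (forall x y, mdist (f x) (f y) <= C * mdist x y `^ a) -> 0 < e < 1 ->
  (entropy_at f e <= (ln (2 * C + 1) + (1 - a) * `|ln e|)%:E)%E.
Proof.
move=> /andP[a0 a1] C0 fC /andP[e0 e1].
pose W := C * e `^ a; pose M := (Num.truncn (2 * W / e)).+1.
have fW x y : mdist x y <= e -> mdist (f x) (f y) <= W.
  move=> xy; apply: le_trans (fC x y) _; apply: ler_wpM2l => //.
  by apply: ge0_ler_powR => //; rewrite nnegrE ?mdist_ge0// ltW.
have count n (A : {fset I}) : Defs.separated f n e [set` A] ->
    (#|` A| <= (Num.truncn (1 / e)).+1 * M ^ n)%N.
  move=> sepA; apply: (@size_le_cells _ 0 1 e) => //.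
    by move=> x _; rewrite add0r; exact: val_I.
  move=> s' ss' cl; apply: size_separated_le fW _ cl _ => //.
    exact: subseq_uniq ss' (fset_uniq A).
  by move=> x y /(mem_subseq ss') xA /(mem_subseq ss') yA; exact: sepA.
apply: le_trans (entropy_le_ln _ _ _ _ _ _ count) _ => //; rewrite lee_fin.
have lne0 : ln e < 0 by rewrite ln_lt0// e0.
have eE : e = expR (ln e) by rewrite lnK.
have WE : W / e = C * expR ((1 - a) * `|ln e|).
  rewrite /W -mulrA {1 2}eE -expRM -expRN -expRD ltr0_norm//.
  by congr (C * expR _); lra.
rewrite -ler_expR lnK ?posrE// expRD lnK ?posrE; last lra.
have W0 : 0 <= 2 * W / e by rewrite -mulrA WE !mulr_ge0// expR_ge0.
have : M%:R <= 2 * W / e + 1.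
  by rewrite /M -natr1 lerD2r; have /andP[] := truncn_itv W0.
move=> /le_trans; apply; rewrite -mulrA WE.
have : 1 <= expR ((1 - a) * `|ln e|).
  by rewrite leNgt expR_lt1 -leNgt mulr_ge0// subr_ge0.
by move: (expR _) => E; lra.
Qed.

End Holder.

(** * Metric mean dimensions as limits in [|ln e|] *)

Section MdimBounds.
Context {R : realType} {X : metricType R}.
Implicit Types (f : X -> X) (b c e B : R).

Lemma near0_ln_ge B : \forall e \near (0 : R)^'+, 0 < e < 1 /\ B <= `|ln e|.
Proof.
near=> e.
have e0 : 0 < e by near: e; exact: nbhs_right_gt.
have e1 : e < 1 by near: e; exact: nbhs_right_lt.
have eB : e <= expR (- B) by near: e; apply: nbhs_right_le; exact: expR_gt0.
split; first by rewrite e0.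
rewrite ltr0_norm ?ln_lt0 ?e0// lerNr -[X in _ <= X]expRK ler_ln// posrE//.
exact: expR_gt0.
Unshelve. all: by end_near. Qed.

Lemma lower_le_upper_mdim f : (lower_mdim f <= upper_mdim f)%E.
Proof.
rewrite /lower_mdim limf_einfE; apply: ge_ereal_sup => _ [V FV <-].
apply: le_ereal_inf_tmp => _ [W FW <-].
have [e [Ve We]] := @filter_ex _ _ (at_right_proper_filter (0 : R)) _ (filterI FV FW).
apply: le_trans (ereal_sup_ubound _); last by exists e.
by apply: ereal_inf_lbound; exists e.
Qed.

Lemma upper_mdim_le f b :
  (forall c, b < c -> exists B, forall e, 0 < e < 1 -> B <= `|ln e| ->
    (entropy_at f e <= (c * `|ln e|)%:E)%E) ->
  (upper_mdim f <= b%:E)%E.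
Proof.
move=> h; apply/lee_addgt0Pr => r r0.
have [B hB] : exists B, forall e, 0 < e < 1 -> B <= `|ln e| ->
    (entropy_at f e <= ((b + r) * `|ln e|)%:E)%E by apply: h; rewrite ltrDl.
apply: ge_ereal_inf; eexists.
  by exists [set e | 0 < e < 1 /\ Num.max B 1 <= `|ln e|] => //; exact: near0_ln_ge.
apply: ge_ereal_sup => _ [e [e01 +] <-]; rewrite ge_max => /andP[eB e1].
have l0 : 0 < `|ln e| by exact: lt_le_trans e1.
rewrite -EFinD; apply: le_trans (lee_wpmul2r _ (hB e e01 eB)) _.
  by rewrite lee_fin invr_ge0.
by rewrite -EFinM mulfK// gt_eqF.
Qed.

Lemma lower_mdim_ge f b :
  (forall c, c < b -> exists B, forall e, 0 < e < 1 -> B <= `|ln e| ->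
    ((c * `|ln e|)%:E <= entropy_at f e)%E) ->
  (b%:E <= lower_mdim f)%E.
Proof.
move=> h; apply/lee_subgt0Pr => r r0.
have [B hB] : exists B, forall e, 0 < e < 1 -> B <= `|ln e| ->
    (((b - r) * `|ln e|)%:E <= entropy_at f e)%E by apply: h; rewrite ltrBlDr ltrDl.
rewrite /lower_mdim limf_einfE; apply: le_ereal_sup_tmp; eexists.
  by exists [set e | 0 < e < 1 /\ Num.max B 1 <= `|ln e|] => //; exact: near0_ln_ge.
apply: le_ereal_inf_tmp => _ [e [e01 +] <-]; rewrite ge_max => /andP[eB e1].
have l0 : 0 < `|ln e| by exact: lt_le_trans e1.
rewrite -EFinB; apply: le_trans (lee_wpmul2r _ (hB e e01 eB)).
  by rewrite -EFinM mulfK// gt_eqF.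
by rewrite lee_fin invr_ge0.
Qed.

(** Unlike the two previous bounds, the entropy has to be large only along a
    sequence of scales: this is the form that a residual set provides. *)
Lemma upper_mdim_ge f b :
  (forall c B, c < b -> exists2 e, 0 < e < 1 /\ B <= `|ln e| &
    ((c * `|ln e|)%:E <= entropy_at f e)%E) ->
  (b%:E <= upper_mdim f)%E.
Proof.
move=> h; apply: le_ereal_inf_tmp => _ [V FV <-].
apply/lee_subgt0Pr => r r0; rewrite -EFinB.
have rb : b - r < b by rewrite ltrBlDr ltrDl.
have [d /= d0 dV] := FV.
have [e [e01]] := h (b - r) (Num.max 1 (1 - ln d)) rb.
rewrite ge_max => /andP[e1 ed] hent.
have l0 : 0 < `|ln e| by exact: lt_le_trans e1.
have /andP[e0 _] := e01.
apply: le_ereal_sup_tmp; eexists; first exists e => //.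
  apply: dV => //=; rewrite sub0r normrN gtr0_norm//.
  by rewrite -ltr_ln ?posrE//; move: ed; rewrite ltr0_norm ?ln_lt0//; lra.
apply: le_trans (lee_wpmul2r _ hent); last by rewrite lee_fin invr_ge0.
by rewrite -EFinM mulfK// gt_eqF.
Qed.

End MdimBounds.

(** * Continuous maps of the interval *)

Section DistMax.
Context {R : realDomainType}.
Implicit Types a b c d w : R.

Lemma dist_max_le a b c d w : `|a - c| <= w -> `|b - d| <= w ->
  `|Num.max a b - Num.max c d| <= w.
Proof.
rewrite !ler_norml => /andP[? ?] /andP[? ?].
by case: (leP a b); case: (leP c d) => ? ?; lra.
Qed.

Lemma dist_min_le a b c d w : `|a - c| <= w -> `|b - d| <= w ->
  `|Num.min a b - Num.min c d| <= w.
Proof.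
rewrite !ler_norml => /andP[? ?] /andP[? ?].
by case: (leP a b); case: (leP c d) => ? ?; lra.
Qed.

End DistMax.

Section ContinuousMaps.
Context {R : realType}.
Notation I := (unit_interval R).
Implicit Types (f g : C0I R) (x y : I).

(** Heine's theorem, read off compactness: the continuity condition at radius
    [d] holds near each point for all small [d], hence uniformly. *)
Lemma C0I_unif_continuous f e : 0 < e ->
  exists2 d, 0 < d & forall x y, mdist x y < d -> mdist (f x) (f y) < e.
Proof.
move=> e0; have := @unit_interval_compact R.
move=> /compact_near_coveringP /(_ R (0 : R)^'+
  (fun d x => forall y, mdist x y < d -> mdist (f x) (f y) < e) _).
case=> [x _|d /= d0 dP]; last first.
  exists (d / 2) => [|x y]; first lra.
  by apply: (dP (d / 2)) => //=; [rewrite sub0r normrN gtr0_norm; lra | lra].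
have fx : nbhs x (f @^-1` ball (f x) (e / 2)).
  have fc : {for x, continuous f} := @cts_fun _ _ (f : continuousType I I) x.
  apply: fc.
  by apply: nbhsx_ballx; lra.
have [d /= d0 dP] := (nbhs_ballP _ _).1 fx.
exists (ball x (d / 2), [set t | t < d / 2]) => /=.
  split; first by apply: nbhsx_ballx; lra.
  by apply: nbhs_right_lt; lra.
move=> [x' t] /= [+ td] y x'y; rewrite ballEmdist /= => xx'.
have bx' : ball x d x' by rewrite ballEmdist /=; lra.
have by' : ball x d y.
  by rewrite ballEmdist /=; have := metric_triangle x x' y; lra.
have := dP _ bx'; have := dP _ by'; rewrite /= !ballEmdist /= => h1 h2.
have := metric_triangle (f x') (f x) (f y).
by rewrite [mdist (f x') (f x)]metric_sym; lra.
Qed.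

Lemma C0I_of_real (F : R -> R) :
  (forall x, 0 <= F (val x) <= 1) ->
  (forall e, 0 < e -> exists2 d, 0 < d &
    forall x y, mdist x y < d -> `|F (val x) - F (val y)| < e) ->
  exists f, forall x, val (f x) = F (val x).
Proof.
move=> F01 Fu; pose h (x : I) : I := insubd unit_interval0 (F (val x)).
have hE x : val (h x) = F (val x).
  by rewrite insubdK// inE /= in_itv /= F01.
have hc : continuous h.
  move=> x V /nbhs_ballP[e /Fu[d d0 dP] eV].
  apply/nbhs_ballP; exists d => // y; rewrite ballEmdist /= => xy.
  by apply: eV; rewrite ballEmdist /= mdistE !hE dP.
by exists (mkcts hc : continuousType I I).
Qed.

(** The intermediate value theorem is applied to [f] extended to the
    real line along the retraction [t |-> max 0 (min 1 t)]. *)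
Lemma C0I_ivt f x y v : val x <= val y -> val (f x) <= v <= val (f y) ->
  exists2 z, val x <= val z <= val y & val (f z) = v.
Proof.
move=> xy fv; pose p (t : R) : I := insubd unit_interval0 (Num.max 0 (Num.min 1 t)).
have pE t : val (p t) = Num.max 0 (Num.min 1 t).
  by rewrite insubdK// inE /= in_itv /= le_max lexx /= ge_max ler01 ge_min lexx.
have pK z : p (val z) = z.
  apply: val_inj; rewrite pE; have /andP[z0 z1] := val_I z.
  by rewrite (min_idPr z1) (max_idPr z0).
have plip s t : mdist (p s) (p t) <= `|s - t|.
  rewrite mdistE !pE; apply: dist_max_le; last by apply: dist_min_le; rewrite ?subrr ?normr0.
  by rewrite subrr normr0.
have [||t tP ft] := @IVT R (fun t => val (f (p t))) (val x) (val y) v xy.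
- apply: continuous_subspaceT => t; apply/cvgrPdist_lt => e e0.
  have [d d0 dP] := C0I_unif_continuous f e e0.
  apply/nbhs_ballP; exists d => // s; rewrite /ball /= => ts.
  by apply: dP; apply: le_lt_trans (plip _ _) ts.
- by rewrite !pK ge_min le_max; move: fv => /andP[-> ->]; rewrite orbT.
exists (p t) => //; move: tP; rewrite in_itv /= => /andP[xt ty].
have /andP[x0 _] := val_I x; have /andP[_ y1] := val_I y.
by rewrite pE (min_idPr (le_trans ty y1)) (max_idPr (le_trans x0 xt)) xt.
Qed.

End ContinuousMaps.

(** * Horseshoes *)

Section Horseshoes.
Context {R : realType}.
Notation I := (unit_interval R).
Implicit Types (f g : C0I R) (b c e : R).

(** The margin [d], common to all legs, makes the existence of a horseshoe an
    open condition on [f]. *)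
Definition horseshoe (f : I -> I) (N : nat) e :=
  exists (l r d : R) (x y : nat -> I), [/\ l <= r, 0 < d,
    forall i, (i < N)%N -> [/\ l <= val (x i) <= val (y i), val (y i) <= r,
      val (f (x i)) + d <= l & r + d <= val (f (y i))] &
    forall i j, (i < j < N)%N -> val (y i) + e < val (x j)].

(** By the intermediate value theorem the image of each leg contains [[l, r]],
    so that legs can be prescribed at all times. *)
Lemma ln_le_entropy_horseshoe f N e : 0 <= e -> horseshoe f N e ->
  ((ln N%:R)%:E <= entropy_at f e)%E.
Proof.
move=> e0 [l [r [d [x [y [lr d0 cross gap]]]]]].
apply: (ln_le_entropy f e N unit_interval0) => n.
case: N cross gap => [|N] cross gap.
  apply: le_trans (max_separated_ge1 f n e unit_interval0).
  by rewrite lee_fin lern1; case: n => // n; rewrite exp0n.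
pose K := [set z : I | l <= val z <= r].
pose J i := [set z : I | val (x i) <= val z <= val (y i)].
apply: (expn_le_max_separated f n e K J N.+1 (x 0%N)) => //.
- by have [/andP[lx xy] yr _ _] := cross 0%N isT; rewrite /K /= lx (le_trans xy).
- move=> i z iN /andP[lz zr]; have [/andP[lx xy] yr fx fy] := cross i iN.
  have [||t /andP[xt ty] ft] := C0I_ivt f (x i) (y i) (val z) => //.
    by apply/andP; split; lra.
  exists t; split; last exact: val_inj.
  + by rewrite /K /= (le_trans lx)// (le_trans ty).
  + by rewrite /J /= xt.
- move=> i j z t iN jN ij /andP[xz zy] /andP[xt ty].
  wlog {ij} ij : i j z t iN jN xz zy xt ty / (i < j)%N.
    move=> h; case: (ltngtP i j) ij => // ij _; first exact: h ij.
    by rewrite metric_sym; exact: h ij.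
  have := gap i j; rewrite ij jN => /(_ isT) g.
  by rewrite mdistE distrC; apply: lt_le_trans (ler_norm _); lra.
Qed.

Lemma near_horseshoe f N e : horseshoe f N e ->
  nbhs f [set g : C0I R | horseshoe g N e].
Proof.
move=> [l [r [d [x [y [lr d0 cross gap]]]]]].
apply/nbhs_ballP; exists (d / 2) => [/=|g]; first lra.
rewrite ballEmdist /= => fg; exists l, r, (d / 2), x, y; split=> //; first lra.
move=> i iN; have [xy yr fx fy] := cross i iN; split=> //.
- by have := le_lt_trans (le_uniform_dist f g (x i)) fg; rewrite mdistE ltr_norml; lra.
- by have := le_lt_trans (le_uniform_dist f g (y i)) fg; rewrite mdistE ltr_norml; lra.
Qed.

(** Scale by scale, at least [e^(-b + o(1))] legs.  The value [ln 0 = 0] makes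
    this trivial for [b = 0]. *)
Definition horseshoe_rich b (f : I -> I) := forall c, c < b ->
  exists B, forall e, 0 < e < 1 -> B <= `|ln e| ->
    exists2 N, horseshoe f N e & c * `|ln e| <= ln N%:R.

Lemma holder_upper_mdim_le b (f : I -> I) : 0 <= b <= 1 -> holder (1 - b) f ->
  (upper_mdim f <= b%:E)%E.
Proof.
move=> b01 [C C0 fC]; apply: upper_mdim_le => c bc.
exists (ln (2 * C + 1) / (c - b)) => e e01 Be.
apply: le_trans (holder_entropy_le f _ C e _ C0 fC e01) _; first lra.
move: Be; rewrite lee_fin ler_pdivrMr; last lra.
by move: (`|ln e|) => L; lra.
Qed.

Lemma upper_mdim_le1 (f : I -> I) : (upper_mdim f <= 1%:E)%E.
Proof.
apply: holder_upper_mdim_le; first lra.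
by exists 1 => // x y; rewrite subrr powRr0 mulr1 mdist_le1.
Qed.

Lemma holder_rich_mdim b f : 0 <= b <= 1 -> holder (1 - b) f ->
  horseshoe_rich b f -> lower_mdim f = b%:E /\ upper_mdim f = b%:E.
Proof.
move=> b01 /(holder_upper_mdim_le b f b01) ub rich.
have lb : (b%:E <= lower_mdim f)%E.
  apply: lower_mdim_ge => c /rich[B rB]; exists B => e e01 Be.
  have [N hN cN] := rB e e01 Be.
  apply: le_trans (ln_le_entropy_horseshoe f N e _ hN); first by rewrite lee_fin.
  by case/andP: e01 => /ltW.
have lu := lower_le_upper_mdim f.
split; apply/eqP; rewrite eq_le ?lb ?ub ?andbT//=.
  exact: le_trans ub.
exact: le_trans lu.
Qed.

(** Having many legs at one scale below [exp(-k)] is an open condition, by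
    [near_horseshoe], and is implied by having many legs at all small scales. *)
Lemma residual_upper_mdim1 : dense [set f : C0I R | horseshoe_rich 1 f] ->
  residual [set f : C0I R | upper_mdim f = 1%:E].
Proof.
move=> rich_dense.
pose U (k : nat) := [set f : C0I R | exists N e, [/\ 0 < e < 1, k%:R <= `|ln e|,
  (1 - k.+1%:R^-1) * `|ln e| <= ln N%:R & horseshoe f N e]].
exists U; split=> [k|f Uf].
  split.
    rewrite openE => f [N [e [e01 ke cN hN]]].
    by apply: filterS (near_horseshoe f N e hN) => g gN; exists N, e.
  move=> O O0 Oopen; have [f [Of rf]] := rich_dense O O0 Oopen.
  exists f; split=> //.
  have [|B rB] := rf (1 - k.+1%:R^-1); first by rewrite ltrBlDr ltrDl invr_gt0.
  have [e [e01]] := @filter_ex _ _ (at_right_proper_filter (0 : R)) _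
    (near0_ln_ge (Num.max B k%:R)).
  rewrite ge_max => /andP[Be ke]; have [N hN cN] := rB e e01 Be.
  by exists N, e.
apply/eqP; rewrite eq_le upper_mdim_le1 /=; apply: upper_mdim_ge => c B c1.
pose k := Num.truncn (Num.max B (1 - c)^-1).
have [N [e [e01 ke cN hN]]] := Uf k.+1 Logic.I.
have kB : Num.max B (1 - c)^-1 <= k.+1%:R by exact/ltW/truncnS_gt.
move: kB; rewrite ge_max => /andP[kB kc].
exists e; first by split=> //; exact: le_trans ke.
apply: le_trans (ln_le_entropy_horseshoe f N e _ hN); last by case/andP: e01 => /ltW.
rewrite lee_fin; apply: le_trans cN; apply: ler_wpM2r => //.
rewrite lerBrDl -lerBrDr invf_ple ?posrE ?subr_gt0//.
by apply: le_trans kc _; rewrite ler_nat.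
Qed.

End Horseshoes.

(** * Lipschitz approximation and almost fixed points *)

Section SupFamily.
Context {R : realType} {T : Type} (t0 : T).
Implicit Types (F G : T -> R) (M w : R).

Lemma le_sup_family F M t : (forall t, F t <= M) -> F t <= sup (range F).
Proof. by move=> FM; apply: ub_le_sup; [exists M => _ [s _ <-]|exists t]. Qed.

Lemma sup_family_le F M : (forall t, F t <= M) -> sup (range F) <= M.
Proof. by move=> FM; apply: ge_sup => [|_ [t _ <-]//]; exists (F t0); exists t0. Qed.

(** A supremum inherits any modulus of continuity shared by its family; this
    serves both the Lipschitz regularization and the series of tents. *)
Lemma dist_sup_family F G M w : (forall t, F t <= M) -> (forall t, G t <= M) ->
  (forall t, `|F t - G t| <= w) -> `|sup (range F) - sup (range G)| <= w.
Proof.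
move=> FM GM FG; rewrite ler_distlC; apply/andP; split.
  rewrite lerBlDr; apply: sup_family_le => t.
  by have := FG t; rewrite ler_distl => /andP[_ h]; have := le_sup_family G M t GM; lra.
apply: sup_family_le => t.
by have := FG t; rewrite ler_distl => /andP[h _]; have := le_sup_family F M t FM; lra.
Qed.

End SupFamily.

Section LipschitzApproximation.
Context {R : realType}.
Notation I := (unit_interval R).
Implicit Types (g : C0I R) (d : R).

(** Lipschitz regularization [G s = sup_y (g y - K |s - y|)].  With [h] given by
    uniform continuity of [g] and [K = 1/h], the points [y] farther than [h]
    from [s] contribute at most [1 - 1], and the others at most [g s + d]. *)
Lemma lipschitz_approx g d : 0 < d -> exists (K : R) (G : R -> R), [/\ 0 <= K,
  forall s t, `|G s - G t| <= K * `|s - t| &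
  forall x : I, val (g x) <= G (val x) <= 1 /\ G (val x) <= val (g x) + d].
Proof.
move=> d0; have [h h0 hg] := C0I_unif_continuous g d d0.
pose K := h^-1; pose F s (y : I) := val (g y) - K * `|s - val y|.
have K0 : 0 <= K by rewrite invr_ge0 ltW.
have F1 s y : F s y <= 1.
  by have /andP[_ g1] := val_I (g y); rewrite /F lerBlDr ler_wpDr// mulr_ge0.
exists K, (fun s => sup (range (F s))); split=> //.
  move=> s t; apply: (dist_sup_family unit_interval0 _ _ 1) => // y.
  rewrite /F; have -> : val (g y) - K * `|s - val y| - (val (g y) - K * `|t - val y|) =
    K * (`|t - val y| - `|s - val y|) by ring.
  rewrite normrM (ger0_norm K0) ler_wpM2l// (le_trans (ler_dist_dist _ _))//.
  by rewrite distrC opprB addrA subrK.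
move=> x; split.
  rewrite (sup_family_le unit_interval0)// andbT.
  have := le_sup_family (F (val x)) 1 x (F1 _).
  by rewrite {1}/F subrr normr0 mulr0 subr0.
apply: (sup_family_le unit_interval0) => y.
have [xy|yx] := ltP (mdist x y) h.
  have := hg _ _ xy; rewrite mdistE ltr_distl => /andP[_ gy].
  have : 0 <= K * `|val x - val y| by rewrite mulr_ge0.
  rewrite /F; have := hg _ _ xy; rewrite mdistE ltr_distl; lra.
have : 1 <= K * `|val x - val y|.
  by rewrite mulrC ler_pdivlMr// mul1r -mdistE.
by have /andP[_ g1] := val_I (g y); have /andP[gx _] := val_I (g x); rewrite /F; lra.
Qed.

(** An exactly fixed point may be [1], leaving no room on its right; moving it
    slightly towards [0] costs little because [G] is Lipschitz. *)
Lemma lipschitz_almost_fixed (K : R) (G : R -> R) d : 0 < d -> 0 <= K ->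
  (forall s t, `|G s - G t| <= K * `|s - t|) ->
  (forall s, 0 <= s <= 1 -> 0 <= G s <= 1) ->
  exists2 q, 0 <= q < 1 & `|G q - q| <= d.
Proof.
move=> d0 K0 Glip G01.
have [||p] := @IVT R (fun s => s - G s) 0 1 0 ler01.
- apply: continuous_subspaceT => s; apply: cvgB; first exact: cvg_id.
  apply/cvgrPdist_lt => e e0; have K1 : 0 < K + 1 by lra.
  apply/nbhs_ballP; exists (e / (K + 1)) => /=; first exact: divr_gt0.
  move=> t; rewrite /ball /= ltr_pdivlMr// => st.
  apply: le_lt_trans (Glip _ _) _; apply: le_lt_trans st.
  by rewrite mulrC ler_wpM2l//; lra.
- have /andP[? ?] : 0 <= G 0 <= 1 by apply: G01; lra.
  have /andP[? ?] : 0 <= G 1 <= 1 by apply: G01; lra.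
  by rewrite ge_min le_max; apply/andP; split; apply/orP; [left|right]; lra.
rewrite in_itv /= => /andP[p0 p1] /eqP; rewrite subr_eq0 => /eqP pG.
pose t := Num.min (d / (K + 1)) 2^-1.
have K1 : 0 < K + 1 by lra.
have t0 : 0 < t by rewrite lt_min divr_gt0//=; lra.
have t2 : t <= 2^-1 by rewrite ge_min lexx orbT.
have td : t * (K + 1) <= d by rewrite -ler_pdivlMr// ge_min lexx.
have tp : 0 <= t * p <= t.
  by rewrite mulr_ge0 ?(ltW t0)//= ger_pMr.
(* Scaling p by 1 - t stays in the interval and leaves 0 in place. *)
exists (p - t * p).
  have : t * p <= 2^-1 * p by rewrite ler_wpM2r.
  have : 0 <= (1 - p) * (1 - t) by rewrite mulr_ge0//; lra.
  lra.
have /andP[tp0 tpt] := tp.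
have := Glip (p - t * p) p.
have -> : `|p - t * p - p| = t * p.
  by rewrite -[RHS]ger0_norm// -normrN; congr (`|_|); ring.
have : K * (t * p) <= K * t by rewrite ler_wpM2l.
by rewrite -pG !ler_norml => ? /andP[? ?]; apply/andP; split; lra.
Qed.

End LipschitzApproximation.

(** * Tents accumulating at a point *)

Section Tent.
Context {R : realType}.
Implicit Types (c r h u v a : R).

Definition tent c r h u : R := h * Num.max 0 (1 - `|u - c| / r).

Lemma tent_bounds c r h u : 0 < r -> 0 <= h -> 0 <= tent c r h u <= h.
Proof.
move=> r0 h0; rewrite mulr_ge0//= ?le_max ?lexx// ler_piMr// ge_max ler01 /=.
by rewrite gerBl divr_ge0// ltW.
Qed.

Lemma tent_center c r h : tent c r h c = h.
Proof. by rewrite /tent subrr normr0 mul0r subr0 (max_idPr _) ?ler01// mulr1. Qed.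

Lemma tent_out c r h u : 0 < r -> r <= `|u - c| -> tent c r h u = 0.
Proof.
move=> r0 ru; rewrite /tent (max_idPl _) ?mulr0//.
by rewrite subr_le0 ler_pdivlMr// mul1r.
Qed.

Lemma tent_lipschitz c r h u v : 0 < r -> 0 <= h ->
  `|tent c r h u - tent c r h v| <= h * (`|u - v| / r).
Proof.
move=> r0 h0; rewrite /tent -mulrBr normrM ger0_norm// ler_wpM2l//.
apply: dist_max_le; first by rewrite subrr normr0 divr_ge0// ltW.
have -> : 1 - `|u - c| / r - (1 - `|v - c| / r) = (`|v - c| - `|u - c|) / r by field; rewrite gt_eqF.
rewrite normrM (@ger0_norm _ r^-1) ?invr_ge0 ?(ltW r0)// ler_wpM2r ?invr_ge0 ?(ltW r0)//.
by rewrite (le_trans (ler_dist_dist _ _))// distrC opprB addrA subrK.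
Qed.

Lemma tent_osc c r h u v : 0 < r -> 0 <= h -> `|tent c r h u - tent c r h v| <= h.
Proof.
move=> r0 h0; have := tent_bounds c r h u r0 h0; have := tent_bounds c r h v r0 h0.
by rewrite ler_norml; lra.
Qed.

Lemma min1_le_powR a (t : R) : 0 <= a <= 1 -> 0 <= t -> Num.min 1 t <= t `^ a.
Proof.
move=> /andP[a0 a1]; rewrite le_eqVlt => /predU1P[<-|t0].
  by rewrite (min_idPr _) ?ler01// powR_ge0.
have [t1|t1] := leP t 1; first by apply: ger1_powR; rewrite ?t0.
rewrite -[X in X <= _](@powRr0 _ t).
by apply: ler_powR => //; exact: ltW.
Qed.

(** A tent varies by at most [h], and by at most [h |u - v| / r]; the minimum of
    the two is dominated by the geometric interpolation of exponent [a]. *)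
Lemma tent_holder c r h a u v : 0 < r -> 0 <= h -> 0 <= a <= 1 ->
  `|tent c r h u - tent c r h v| <= h / r `^ a * `|u - v| `^ a.
Proof.
move=> r0 h0 a01; have ur : 0 <= `|u - v| / r by rewrite divr_ge0// ltW.
have -> : h / r `^ a * `|u - v| `^ a = h * (`|u - v| / r) `^ a.
  have rV : r^-1 `^ a = (r `^ a)^-1.
    by rewrite -(@powR_inv1 _ r) ?ltW// powRAC powR_inv1 ?powR_ge0.
  by rewrite powRM ?invr_ge0 ?(ltW r0)// rV; ring.
apply: le_trans (_ : h * Num.min 1 (`|u - v| / r) <= _).
  by case: (leP 1 (`|u - v| / r)) => _; rewrite ?mulr1 ?tent_osc ?tent_lipschitz.
by rewrite ler_wpM2l// min1_le_powR.
Qed.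

End Tent.

Section TentSeries.
Context {R : realType} (b : R).
Hypothesis b01 : 0 <= b <= 1.
Implicit Types (k i : nat) (u v e : R).

(** The ratio of [ln (width k.+1)] to [ln (width k)] tends to [1]: passing from
    a scale [e] to the nearest width costs nothing in dimension. *)
Definition width k : R := expR (- k%:R ^+ 2).

(** [height k = width k ^ (1 - b) * exp(-2k)]: the power is what the Hoelder
    exponent [1 - b] allows, and the factor [exp(-2k)] keeps the blocks disjoint
    and shrinking to [0], also when [b = 1]. *)
Definition height k : R := expR (- (1 - b) * k%:R ^+ 2 - 2 * k%:R).

Definition foot k i : R := height k / 3 + width k * i%:R.
Definition peak k i : R := foot k i + width k / 2.

(** With [i] ranging over [nat], block [k] vanishes on the left of
    [height k / 3] and is periodic on the right of it. *)
Definition tents u : R :=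
  sup (range (fun p : nat * nat => tent (peak p.1 p.2) (width p.1 / 2) (height p.1) u)).

Let width_gt0 k : 0 < width k. Proof. exact: expR_gt0. Qed.
Let width2_gt0 k : 0 < width k / 2. Proof. by have := width_gt0 k; lra. Qed.
Let height_gt0 k : 0 < height k. Proof. exact: expR_gt0. Qed.
Let height_ge0 k : 0 <= height k. Proof. exact: expR_ge0. Qed.

Lemma height_le k : height k <= expR (- (2 * k%:R)).
Proof.
have /andP[b0 b1] := b01; rewrite ler_expR.
have : 0 <= (1 - b) * k%:R ^+ 2 by rewrite mulr_ge0 ?exprn_ge0//; lra.
lra.
Qed.

Lemma height_le1 k : height k <= 1.
Proof. by apply: le_trans (height_le k) _; rewrite expR_le1 oppr_le0 mulr_ge0. Qed.

(** Block [k + 1] stays below the base [height k / 3] of block [k]. *)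
Lemma height_succ k : height k.+1 < height k / 3.
Proof.
have /andP[b0 b1] := b01; have e2 : 3 < expR 2 :> R.
  by have := @expR_gt1Dx R 2 ltac:(by rewrite pnatr_eq0); lra.
have hk : height k.+1 * expR 2 <= height k.
  rewrite /height -expRD ler_expR -natr1.
  have : 0 <= (1 - b) * (2 * k%:R + 1).
    by apply: mulr_ge0; [lra | have : 0 <= k%:R :> R by []; lra].
  lra.
have : height k.+1 * 3 < height k.+1 * expR 2 by rewrite ltr_pM2l.
lra.
Qed.

Lemma height_anti j k : (j <= k)%N -> height k <= height j.
Proof.
move=> /subnKC <-; elim: (k - j)%N => [|n IH]; first by rewrite addn0.
rewrite addnS; apply: le_trans IH; have := height_succ (j + n).
by have := height_gt0 (j + n); lra.
Qed.

Let le_tents M u : (forall k i, tent (peak k i) (width k / 2) (height k) u <= M) ->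
  tents u <= M.
Proof. by move=> h; apply: (sup_family_le (0%N, 0%N)) => -[k i]; exact: h. Qed.

Let tent_le1 u (p : nat * nat) : tent (peak p.1 p.2) (width p.1 / 2) (height p.1) u <= 1.
Proof.
have /andP[_] := tent_bounds (peak p.1 p.2) _ _ u (width2_gt0 p.1) (height_ge0 p.1).
by move/le_trans; apply; exact: height_le1.
Qed.

Let tent_le_tents k i u : tent (peak k i) (width k / 2) (height k) u <= tents u.
Proof. exact: (le_sup_family _ 1 (k, i) (tent_le1 u)). Qed.

Lemma tents_ge0 u : 0 <= tents u.
Proof.
apply: le_trans (tent_le_tents 0 0 u).
by have /andP[] := tent_bounds (peak 0 0) _ _ u (width2_gt0 0) (height_ge0 0).
Qed.

(** The Hoelder constants [height k / (width k / 2) ^ (1 - b)] of the tents are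
    bounded uniformly in [k]. *)
Lemma tents_holder u v : `|tents u - tents v| <= 2 * `|u - v| `^ (1 - b).
Proof.
apply: (dist_sup_family (0%N, 0%N) _ _ 1); try exact: tent_le1.
have /andP[b0 b1] := b01; move=> [k i] /=; have b1' : 0 <= 1 - b <= 1 by lra.
apply: le_trans (tent_holder _ _ _ _ _ _ (width2_gt0 k) (height_ge0 k) b1') _.
apply: ler_wpM2r; first exact: powR_ge0.
rewrite ler_pdivrMr ?powR_gt0//.
apply: le_trans (_ : width k `^ (1 - b) <= _).
  rewrite /height /width -expRM ler_expR.
  by have : 0 <= k%:R :> R by []; lra.
rewrite powRM ?(ltW (width_gt0 k)) ?invr_ge0// mulrCA ler_peMr ?powR_ge0//.
have := @min1_le_powR R (1 - b) 2^-1 b1'; rewrite invr_ge0 => /(_ (ler0n _ _)).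
rewrite (min_idPr _); last by rewrite invf_le1// ler1n.
by lra.
Qed.

(** Blocks [k >= K] oscillate by at most [exp(-2K)] and the finitely many others
    are Lipschitz.  This covers [b = 1], for which [tents_holder] says
    nothing about continuity. *)
Lemma tents_unif_continuous e : 0 < e ->
  exists2 d, 0 < d & forall u v, `|u - v| < d -> `|tents u - tents v| <= e.
Proof.
have /andP[b0 b1] := b01; move=> e0; pose K := (Num.truncn e^-1).+1.
have Ke : expR (- (2 * K%:R)) <= e.
  rewrite expRN invf_ple ?posrE ?expR_gt0//.
  apply: le_trans (ltW (truncnS_gt _)) _; apply: le_trans (expR_ge1Dx _).
  have : 0 <= K%:R :> R by []. rewrite -/K; lra.
exists (e / (2 * expR (K%:R ^+ 2))); first by rewrite divr_gt0 ?mulr_gt0 ?expR_gt0.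
move=> u v; rewrite ltr_pdivlMr ?mulr_gt0 ?expR_gt0// => uv.
apply: (dist_sup_family (0%N, 0%N) _ _ 1); try exact: tent_le1.
move=> [k i] /=; have [Kk|kK] := leqP K k.
  apply: le_trans (tent_osc _ _ _ _ _ (width2_gt0 k) (height_ge0 k)) _.
  by apply: le_trans Ke; apply: le_trans (height_anti _ _ Kk) _; exact: height_le.
apply: le_trans (tent_lipschitz _ _ _ _ _ (width2_gt0 k) (height_ge0 k)) _.
apply: le_trans (ltW uv).
have -> : height k * (`|u - v| / (width k / 2)) = `|u - v| * (2 * (height k / width k)).
  by field; rewrite gt_eqF.
apply: ler_wpM2l => //; rewrite ler_pM2l// /height /width -expRN -expRD ler_expR.
have : k%:R ^+ 2 <= K%:R ^+ 2 :> R by rewrite lerXn2r ?nnegrE// ler_nat ltnW.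
have : b * k%:R ^+ 2 <= 1 * k%:R ^+ 2 by rewrite ler_wpM2r ?exprn_ge0//; lra.
by have : 0 <= k%:R :> R by []; lra.
Qed.

(** The feet of block [k] are zeros of its own tents, and lie to the left of all
    larger blocks, so that only the smaller blocks are seen there. *)
Lemma tents_foot k i : foot k i <= height k -> tents (foot k i) <= height k.+1.
Proof.
move=> fk; apply: le_tents => j i'.
have [jk|kj|->] := ltngtP j k.
- rewrite tent_out//.
  have : height k <= height j / 3.
    by apply: le_trans (height_anti _ _ jk) _; apply/ltW/height_succ.
  have : 0 <= width j * i'%:R by rewrite mulr_ge0// ltW.
  have -> : peak j i' = height j / 3 + width j * i'%:R + width j / 2 by [].
  by have := width_gt0 j => ? ? ?; rewrite ler0_norm; lra.
- have /andP[_] := tent_bounds (peak j i') _ _ (foot k i) (width2_gt0 j) (height_ge0 j).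
  by move/le_trans; apply; exact: height_anti.
- rewrite tent_out//; have w0 := width_gt0 k.
  have -> : foot k i - peak k i' = width k * (i%:R - i'%:R - 2^-1).
    by rewrite /peak /foot; field.
  rewrite normrM gtr0_norm// ler_pM2l//.
  have [ii'|i'i] := leqP i i'.
    have : i%:R <= i'%:R :> R by rewrite ler_nat.
    by move=> ?; rewrite ler0_norm; lra.
  have : i'%:R + 1 <= i%:R :> R by rewrite natr1 ler_nat.
  by move=> ?; rewrite ger0_norm; lra.
Qed.

Lemma tents_peak k i : height k <= tents (peak k i).
Proof. by have := tent_le_tents k i (peak k i); rewrite tent_center. Qed.

Definition legs k : nat := Num.truncn (height k / (3 * width k)).

(** The number of legs is at least half of [exp(b k^2 - 2k) / 3] if this is at
    least [1]; otherwise [b k^2 - 2k < ln 3] and [legs k = 0].  In both cases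
    [exp 5 >= 6] absorbs the constants. *)
Lemma ln_legs k : b * k%:R ^+ 2 - 2 * k%:R - 5 <= ln (legs k)%:R.
Proof.
have hw : height k / (3 * width k) = expR (b * k%:R ^+ 2 - 2 * k%:R) / 3.
  rewrite invfM mulrCA mulrC [in LHS]/height /width -expRN -expRD.
  by congr (expR _ / 3); ring.
rewrite /legs hw; set x := b * _ - _; have e5 : 6 <= expR 5 :> R.
  by have := expR_ge1Dx (5 : R); lra.
have [x3|x3] := leP 3 (expR x).
  have x1 : 1 <= expR x / 3 by lra.
  have N1 : 1 <= (Num.truncn (expR x / 3))%:R :> R by rewrite ler1n truncn_gt0.
  have := truncnS_gt (expR x / 3); rewrite -[X in _ < X]natr1 => Nx.
  rewrite -ler_expR lnK ?posrE; last exact: lt_le_trans N1.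
  rewrite expRB ler_pdivrMr ?expR_gt0//.
  have : 6 * (Num.truncn (expR x / 3))%:R <= expR 5 * (Num.truncn (expR x / 3))%:R :> R.
    by rewrite ler_wpM2r//; lra.
  lra.
have -> : Num.truncn (expR x / 3) = 0%N by apply/truncn0Pn; rewrite -ltNge; lra.
have : expR x < expR 5 by lra.
by rewrite ltr_expR ln0// => x5; lra.
Qed.

End TentSeries.

(** * Density of Hoelder maps rich in horseshoes *)

Section Density.
Context {R : realType}.
Notation I := (unit_interval R).
Implicit Types (f g : C0I R) (b c d e : R).

(** With [s = sqrt |ln e|], the block [k] with [s - 2 < k <= s - 1] has
    tents wider than [2 e], and [b k^2 - 2k - 5 >= b s^2 - 6s - 5 >= c s^2] once
    [(b - c) s >= 11] and [s >= 1]. *)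
Lemma legs_rich b (f : I -> I) (k0 : nat) : 0 <= b <= 1 ->
  (forall k e, (k0 <= k)%N -> e < width k / 2 -> horseshoe f (legs b k) e) ->
  horseshoe_rich b f.
Proof.
move=> /andP[b0 b1] hf c cb; have bc : 0 < b - c by rewrite subr_gt0.
have q0 : 0 <= 11 / (b - c) by rewrite divr_ge0// ltW.
pose A := k0%:R + 3 + 11 / (b - c); exists (A ^+ 2) => e /andP[e0 e1] AL.
have A3 : k0%:R + 3 <= A by rewrite /A; lra.
have Ac : 11 <= (b - c) * A.
  by rewrite mulrC -ler_pdivrMr// /A lerDr addr_ge0.
set L := `|ln e| in AL *.
pose s := Num.sqrt L; have s2 : s ^+ 2 = L by rewrite /s sqr_sqrtr ?normr_ge0.
have A0 : 0 <= A by apply: le_trans A3; rewrite addr_ge0.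
have As : A <= s by rewrite -(ger0_norm A0) -sqrtr_sqr ler_wsqrtr.
have sc : 11 <= (b - c) * s.
  by apply: le_trans Ac _; rewrite ler_pM2l.
have k00 : 0 <= k0%:R :> R by [].
have [k ks sk] : exists2 k : nat, k%:R + 1 <= s & s < k%:R + 2.
  have s1 : (0 < Num.truncn s)%N by rewrite truncn_gt0; lra.
  have s0 : 0 <= s by lra.
  have /andP[h1 h2] := truncn_itv s0; exists (Num.truncn s).-1.
    by rewrite natr1 prednK.
  by move: h2; rewrite -[in X in X -> _](prednK s1) -!natr1; lra.
have k0k : (k0 <= k)%N by rewrite -(@ler_nat R); lra.
have k1 : 0 <= k%:R :> R by [].
have ek : e < width k / 2.
  have e2 : ln (2 : R) <= 1 by have := @le_ln1Dx R 1; rewrite -natr1; apply; lra.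
  rewrite -ltr_ln ?posrE//; last by rewrite divr_gt0// expR_gt0.
  rewrite ln_div ?posrE// ?expR_gt0// expRK.
  have : L = - ln e by rewrite /L ltr0_norm// ln_lt0// e0.
  have : (k%:R + 1) ^+ 2 <= s ^+ 2 by rewrite lerXn2r ?nnegrE; lra.
  have : 1 <= k%:R :> R by lra.
  rewrite s2; lra.
exists (legs b k); first exact: hf.
apply: le_trans (ln_legs b k).
have : b * (s - 2) ^+ 2 <= b * k%:R ^+ 2.
  by rewrite ler_wpM2l// lerXn2r ?nnegrE; lra.
have : 0 <= (1 - b) * s by rewrite mulr_ge0; lra.
have : 11 * s <= (b - c) * s * s by rewrite ler_wpM2r; lra.
by rewrite -s2; lra.
Qed.

Definition clamped_tents b q d (G : R -> R) s : R :=
  Num.max (G s - d) (Num.min (G s + d) (Num.min 1 (q + tents b (s - q)))).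

(** When [[G - d, G + d]] contains [[q, q + height k]] above block [k], the clamp
    neither raises the feet above [q + height k.+1] nor lowers the peaks below
    [q + height k]: the oscillation of the block survives. *)
Lemma horseshoe_clamped_tents b q d (G : R -> R) (f : I -> I) k e :
  0 <= b <= 1 -> 0 <= q -> q + height b k <= 1 ->
  (forall x, val (f x) = clamped_tents b q d G (val x)) ->
  (forall u, 0 <= u <= height b k ->
    G (q + u) - d <= q /\ q + height b k <= G (q + u) + d) ->
  e < width k / 2 -> horseshoe f (legs b k) e.
Proof.
move=> b01 q0 hq fE near ek.
have w0 : 0 < width k :> R by exact: expR_gt0.
have hs := height_succ b b01 k.
have h1 : 0 < height b k.+1 := expR_gt0 _.
have legs_le i : (i < legs b k)%N -> width k * i%:R + width k <= height b k / 3.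
  rewrite /legs truncn_gt_nat ler_pdivlMr ?mulr_gt0// -natr1.
  by lra.
pose pt u : I := insubd unit_interval0 (q + u).
have ptE u : 0 <= u <= height b k -> val (pt u) = q + u.
  by move=> /andP[u0 u1]; rewrite insubdK// inE /= in_itv /=; apply/andP; split; lra.
have footE i : foot b k i = height b k / 3 + width k * i%:R by [].
have peakE i : peak b k i = foot b k i + width k / 2 by [].
have wi i : 0 <= width k * i%:R :> R by rewrite mulr_ge0// ltW.
have footI i : (i < legs b k)%N -> 0 <= foot b k i <= height b k.
  by move=> /legs_le li; rewrite footE; have := wi i; lra.
have peakI i : (i < legs b k)%N -> 0 <= peak b k i <= height b k.
  by move=> /legs_le li; rewrite peakE footE; have := wi i; lra.
exists (q + height b k / 3), (q + 2 * height b k / 3),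
  (height b k / 3 - height b k.+1), (fun i => pt (foot b k i)),
  (fun i => pt (peak b k i)).
split; [lra|lra| |].
  move=> i il; have li := legs_le i il; have wi' := wi i.
  have [n1 _] := near _ (footI i il); have [_ n2] := near _ (peakI i il).
  rewrite !fE !ptE ?footI ?peakI//; split.
  - by rewrite peakE footE; lra.
  - by rewrite peakE footE; lra.
  - have : clamped_tents b q d G (q + foot b k i) <= q + height b k.+1.
      rewrite /clamped_tents ge_max !ge_min; apply/andP; split.
        by apply: le_trans n1 _; rewrite lerDl ltW.
      apply/orP; right; apply/orP; right; rewrite lerD2l addrAC subrr add0r.
      by apply: tents_foot => //; have /andP[] := footI i il.
    lra.
  - have : q + height b k <= clamped_tents b q d G (q + peak b k i).
      rewrite /clamped_tents le_max !le_min; apply/orP; right.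
      apply/and3P; split=> //.
      by rewrite lerD2l [q + peak b k i]addrC addrK; exact: tents_peak.
    lra.
move=> i j /andP[ij jl]; have il := ltn_trans ij jl.
rewrite !ptE ?footI ?peakI// peakE !footE.
have : i%:R + 1 <= j%:R :> R by rewrite natr1 ler_nat.
move=> /(ler_wpM2l (ltW w0)); rewrite mulrDr mulr1; lra.
Qed.

(** The clamp keeps the Hoelder exponent of the tents, since [min] and [max]
    are 1-Lipschitz and [G] is Lipschitz. *)
Lemma clamped_tents_rich b q d (K : R) (G : R -> R) : 0 <= b <= 1 -> 0 <= q < 1 ->
  0 < d -> 0 <= K ->
  (forall s t, `|G s - G t| <= K * `|s - t|) ->
  (forall s, 0 <= s <= 1 -> 0 <= G s <= 1) -> `|G q - q| <= d / 2 ->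
  exists f : C0I R, [/\ forall x, `|val (f x) - G (val x)| <= d,
    holder (1 - b) f & horseshoe_rich b f].
Proof.
move=> b01 /andP[q0 q1] d0 K0 Glip G01 Gq.
pose F := clamped_tents b q d G.
have GI (x : I) : 0 <= G (val x) <= 1 by apply: G01; exact: val_I.
(* F stays in [0, 1] because both G and the clamped function do. *)
have F01 (x : I) : 0 <= F (val x) <= 1.
  have /andP[g0 g1] := GI x; have t0 := tents_ge0 b b01 (val x - q).
  apply/andP; split.
    by rewrite /F /clamped_tents le_max !le_min; apply/orP; right; apply/and3P; split; lra.
  by rewrite /F /clamped_tents ge_max !ge_min lexx orbT andbT; lra.
have Fdist s t w : K * `|s - t| <= w -> `|tents b (s - q) - tents b (t - q)| <= w ->
    `|F s - F t| <= w.
  move=> /(le_trans (Glip s t)) Gw tw.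
  apply: dist_max_le; first by rewrite opprB addrA subrK.
  apply: dist_min_le; first by rewrite opprD addrACA subrr addr0.
  apply: dist_min_le; last by rewrite opprD addrACA subrr add0r.
  by rewrite subrr normr0; exact: le_trans Gw.
have [|f fE] := C0I_of_real F F01.
  move=> e e0; have e2 : 0 < e / 2 by lra.
  have [d1 d10 hd1] := tents_unif_continuous b b01 (e / 2) e2.
  exists (Num.min d1 (e / (2 * (K + 1)))).
    by rewrite lt_min d10 divr_gt0//; lra.
  move=> x y; rewrite lt_min mdistE => /andP[xy1].
  rewrite ltr_pdivlMr; last lra.
  move=> xy2; apply: le_lt_trans (_ : e / 2 < e); last lra.
  apply: Fdist; first by have := normr_ge0 (val x - val y); lra.
  by apply: hd1; rewrite opprB addrA subrK.
exists f; split.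
- move=> x; rewrite fE ler_norml /F /clamped_tents.
  by case: (leP (G (val x) - d)); case: (leP (G (val x) + d)); lra.
- exists (K + 2) => [|x y]; first lra.
  rewrite mdistE !fE; have xy1 := mdist_le1 x y.
  have xyb : mdist x y <= mdist x y `^ (1 - b).
    have b1 : 0 <= 1 - b <= 1 by lra.
    by apply: le_trans (min1_le_powR (1 - b) _ b1 (mdist_ge0 _ _)); rewrite (min_idPr xy1).
  have p0 : 0 <= mdist x y `^ (1 - b) by exact: powR_ge0.
  apply: Fdist.
    apply: le_trans (_ : K * mdist x y `^ (1 - b) <= _); first by rewrite ler_wpM2l.
    by rewrite ler_wpM2r//; lra.
  apply: le_trans (tents_holder b b01 _ _) _.
  rewrite opprB addrA subrK -mdistE; apply: ler_wpM2r => //; lra.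
- (* Block k fits in [q, 1] and in the region where G is close to q as soon as
     its height is at most m. *)
  pose m := Num.min (1 - q) (d / (2 * (K + 1))).
  have m0 : 0 < m by rewrite lt_min subr_gt0 q1 divr_gt0//; lra.
  apply: (legs_rich b f (Num.truncn m^-1).+1 b01) => k e k0k ek.
  have hm : height b k <= m.
    apply: le_trans (height_le b b01 k) _; rewrite expRN invf_ple ?posrE ?expR_gt0//.
    apply: le_trans (ltW (truncnS_gt _)) _; apply: le_trans (expR_ge1Dx _).
    have : (Num.truncn m^-1).+1%:R <= k%:R :> R by rewrite ler_nat.
    by have : 0 <= k%:R :> R by []; lra.
  have h0 : 0 < height b k by exact: expR_gt0.
  have [hq hd] : height b k <= 1 - q /\ height b k * (2 * (K + 1)) <= d.
    move: hm; rewrite le_min => /andP[-> h]; split=> //.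
    by rewrite -ler_pdivlMr//; lra.
  apply: (horseshoe_clamped_tents b q d G f k e b01 q0 _ fE _ ek); first by lra.
  move=> u /andP[u0 u1]; have := Glip (q + u) q.
  rewrite addrAC subrr add0r (ger0_norm u0) => Gu.
  have : K * u <= K * height b k by rewrite ler_wpM2l.
  by move: Gu Gq; rewrite !ler_norml => /andP[? ?] /andP[? ?]; split; lra.
Qed.

(** The distance [d] is shared equally between the regularization [G] of [g] and
    the clamp around [G]. *)
Lemma dense_holder_rich b : 0 <= b <= 1 ->
  dense [set f : C0I R | holder (1 - b) f /\ horseshoe_rich b f].
Proof.
move=> b01 O [g Og] Oopen.
have /nbhs_ballP[d /= d0 dO] : nbhs g O by exact: open_nbhs_nbhs.
have d4 : 0 < d / 4 by lra.
have d8 : 0 < d / 4 / 2 by lra.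
have [K [G [K0 Glip Gg]]] := lipschitz_approx g (d / 4) d4.
have G01 s : 0 <= s <= 1 -> 0 <= G s <= 1.
  move=> s01; pose x : I := insubd unit_interval0 s.
  have xE : val x = s by rewrite insubdK// inE /= in_itv.
  have [/andP[gx G1] _] := Gg x; rewrite -xE G1 andbT.
  by have /andP[g0 _] := val_I (g x); exact: le_trans gx.
have [q q01 Gq] := lipschitz_almost_fixed K G _ d8 K0 Glip G01.
have [f [fG fh fr]] := clamped_tents_rich b q (d / 4) K G b01 q01 d4 K0 Glip G01 Gq.
exists f; split=> //; apply: dO; rewrite ballEmdist /=.
have [x gf _] := uniform_dist_max g f.
change (uniform_dist g f < d); rewrite gf mdistE.
have := fG x; have [/andP[gx _] Gx] := Gg x.
by rewrite ler_norml ltr_norml => /andP[? ?]; apply/andP; split; lra.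
Qed.

End Density.

Theorem theorem2 (R : realType) :
  (forall beta : R, 0 <= beta <= 1 ->
     exists D : set (C0I R), dense D /\
       forall f : C0I R, D f ->
         lower_mdim f = beta%:E /\ upper_mdim f = beta%:E) /\
  (exists A : set (C0I R), residual A /\
     forall f : C0I R, A f -> upper_mdim f = 1%:E).
Proof.
split=> [b b01|].
  exists [set f : C0I R | holder (1 - b) f /\ horseshoe_rich b f].
  split; first exact: dense_holder_rich.
  by move=> f [fh fr]; exact: holder_rich_mdim.
exists [set f : C0I R | upper_mdim f = 1%:E]; split=> //.
apply: residual_upper_mdim1 => O O0 Oopen.
have b01 : 0 <= (1 : R) <= 1 by rewrite ler01 lexx.
by have [f [Of [_ fr]]] := dense_holder_rich 1 b01 O O0 Oopen; exists f.
Qed.
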